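(* Let $C>0$ and suppose that $$R[z]<C\,z\,|R_z|$$ holds on some interval $I=[z_0,z_1)\subset\mathbb R^+$. Let $\xi$ be a solution on $I$ of $$\frac{d\xi}{dz}=\frac{\sqrt6\sqrt{1+\xi}}{1+z}+\xi\,\frac{R_z}{R}\left(\frac{\sqrt3\sqrt{1+\xi}}{\sqrt3-\sqrt{2+2\xi}}\right),\qquad \xi(z_0)=\xi_0,$$ and let $M[z]=R[z]\,\xi[z]$. Then the following statements hold for some constants $0<c_1<1/2<c_2$, each depending on the choice of $C$ (and on $\xi_0$): (1) If $0<\xi_0<1/2$ and $R_z<0$ on $I$, then $M[z]\le c_1R[z]$ holds on $I$. (2) If $\xi_0>1/2$ and $R_z>0$ on $I$, then $M[z]\le c_2R[z]$ holds on $I$.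
   Context: Setting: the Lemaître–Tolman–Bondi system with constant $E\equiv1$ and $\sigma=\operatorname{sgn}\partial_tR=1$, $\delta=\operatorname{sgn}\partial_rR=1$. The function $R[z]$ is a given smooth positive function of the redshift $z>0$, and $R_z=dR[z]/dz$. $M[z]$ is the value along the null geodesic of the unknown function $M$, and $\xi=M/R$; in this case the equation for $\xi$ decouples from those for the geodesic coordinates $(r,t)$ and is the differential equation displayed in the claim. *)

(* Defs.v *)
From Stdlib Require Import Reals.
From Coquelicot Require Import Coquelicot.
Open Scope R_scope.

(* The half-open interval [z0, z1); the right end point may be [p_infty]. *)
Definition Ico (z0 : R) (z1 : Rbar) (z : R) : Prop :=
  z0 <= z /\ Rbar_lt (Finite z) z1.

Definition smooth_pos (f : R -> R) : Prop :=
  (forall z, 0 < z -> 0 < f z) /\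
  (forall (n : nat) z, 0 < z -> ex_derive_n f n z).

Definition ltb_rhs (Rad : R -> R) (z x : R) : R :=
  sqrt 6 * sqrt (1 + x) / (1 + z)
  + x * (Derive Rad z / Rad z)
    * (sqrt 3 * sqrt (1 + x) / (sqrt 3 - sqrt (2 + 2 * x))).

(* [sqrt] and [/] are total, so a solution is required to stay in the set
   where the right-hand side is defined.  [D_in] is the derivative relative to
   the interval, hence the right derivative at [z0]. *)
Definition ltb_solution (Rad : R -> R) (z0 : R) (z1 : Rbar) (xi0 : R)
    (xi : R -> R) : Prop :=
  xi z0 = xi0 /\
  forall z, Ico z0 z1 z ->
    0 <= 1 + xi z /\
    sqrt 3 - sqrt (2 + 2 * xi z) <> 0 /\
    D_in xi (fun y => ltb_rhs Rad y (xi y)) (Ico z0 z1) z.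

(* Main.v *)
Require Import Defs.
From Stdlib Require Import Reals Lra Psatz.
From Coquelicot Require Import Coquelicot.
Open Scope R_scope.

(** Write [d(x) = sqrt 3 - sqrt (2 + 2 x)], which vanishes exactly at
    [x = 1/2].  Factoring the right-hand side of the equation gives
    [sqrt 3 * sqrt (1 + x) * (sqrt 2 / (1 + z) + x (R_z / R) / d(x))].
    When [R_z] and [d(x)] have opposite signs, the second term is negative, and
    the hypothesis [R < C z |R_z|] makes its size larger than
    [x / (C z |d(x)|)].  It therefore beats [sqrt 2 / (1 + z)], uniformly in
    [z], as soon as [sqrt 2 * C * |d(x)| <= x] ([ltb_rhs_neg]).  A level [c]
    satisfying this inequality is one that a solution starting at or below [c]
    can never cross upwards ([barrier]).

    Such levels exist on both sides of [1/2], and can be taken above the initial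
    value.  Below [1/2], where [R_z < 0] gives the opposite signs, [d] tends to
    [0] at [1/2], so any [c] close enough to [1/2] works
    ([barrier_level_below]).  Above [1/2], where [R_z > 0] does, [|d(c)|] grows
    only like [sqrt c], so any large [c] works ([barrier_level_above]).  In both
    cases [M / R = xi <= c] follows. *)

(** If [f w > c], there is a last time [s] before [w] with [f s <= c].  That is
    absurd: if [f s < c], continuity keeps [f] below [c] a little longer, and if
    [f s = c], the negative derivative does. *)
Lemma barrier (f df : R -> R) (z0 : R) (z1 : Rbar) (c : R) :
  (forall z, Ico z0 z1 z -> D_in f df (Ico z0 z1) z) ->
  f z0 <= c ->
  (forall z, Ico z0 z1 z -> f z = c -> df z < 0) ->
  forall z, Ico z0 z1 z -> f z <= c.
Proof.
intros Hd H0 Hneg w [Hw0 Hw1].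
destruct (Rle_or_lt (f w) c) as [H | Hw]; [exact H | exfalso].
pose (E := fun y => z0 <= y <= w /\ f y <= c).
assert (HE0 : E z0) by (unfold E; lra).
destruct (completeness E) as [s [Hub Hlub]].
{ exists w; intros y [Hy _]; lra. }
{ exists z0; exact HE0. }
assert (Hs0 : z0 <= s) by exact (Hub _ HE0).
assert (Hsw : s <= w) by (apply Hlub; intros y [Hy _]; lra).
assert (HI : forall y, z0 <= y <= w -> Ico z0 z1 y).
{ intros y Hy; split; [lra |].
  apply (Rbar_le_lt_trans _ (Finite w)); [simpl; lra | exact Hw1]. }
pose proof (Hd s (HI s (conj Hs0 Hsw))) as Hds.
pose proof (cont_deriv _ _ _ _ Hds) as Hcs.
destruct (Rlt_or_le c (f s)) as [Hfs | Hfs].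
- (* By continuity [f > c] just before [s], so a smaller upper bound exists. *)
  destruct (Hcs (f s - c)) as [a [Ha Hcl]]; [lra |].
  assert (s <= s - a); [| lra].
  apply Hlub; intros y Hy.
  destruct (Rle_or_lt y (s - a)) as [H | Hya]; [exact H | exfalso].
  pose proof (Hub y Hy) as Hys.
  destruct Hy as [Hy1 Hy2].
  assert (Hne : s <> y) by (intros ->; lra).
  specialize (Hcl y); simpl in Hcl; unfold Rdist in Hcl.
  assert (H : Rabs (f y - f s) < f s - c).
  { apply Hcl; split; [split; [apply HI; exact Hy1 | exact Hne] |].
    apply Rabs_def1; lra. }
  apply Rabs_def2 in H; lra.
- (* Otherwise [E] has points beyond [s]. *)
  assert (Hlt : s < w).
  { destruct (Req_dec s w) as [-> | H]; lra. }
  assert (Hex : exists a, 0 < a /\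
            forall y, s < y < s + a -> y <= w -> f y <= c).
  { destruct (Req_dec (f s) c) as [Heq | Hne].
    - pose proof (Hneg s (HI s (conj Hs0 Hsw)) Heq) as Hn.
      destruct (Hds (- df s)) as [a [Ha Hcl]]; [lra |].
      exists a; split; [exact Ha |]; intros y Hy Hyw.
      specialize (Hcl y); simpl in Hcl; unfold Rdist in Hcl.
      assert (H : Rabs ((f y - f s) / (y - s) - df s) < - df s).
      { apply Hcl; split; [split; [apply HI; lra | lra] |].
        apply Rabs_def1; lra. }
      apply Rabs_def2 in H.
      assert (Hq : f y - f s = (f y - f s) / (y - s) * (y - s))
        by (field; lra).
      nra.
    - destruct (Hcs (c - f s)) as [a [Ha Hcl]]; [lra |].
      exists a; split; [exact Ha |]; intros y Hy Hyw.
      specialize (Hcl y); simpl in Hcl; unfold Rdist in Hcl.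
      assert (H : Rabs (f y - f s) < c - f s).
      { apply Hcl; split; [split; [apply HI; lra | lra] |].
        apply Rabs_def1; lra. }
      apply Rabs_def2 in H; lra. }
  destruct Hex as [a [Ha Hright]].
  pose proof (Rmin_l (a / 2) (w - s)).
  pose proof (Rmin_r (a / 2) (w - s)).
  assert (0 < Rmin (a / 2) (w - s)) by (apply Rmin_glb_lt; lra).
  assert (HE : E (s + Rmin (a / 2) (w - s))).
  { split; [lra | apply Hright; lra]. }
  pose proof (Hub _ HE); lra.
Qed.

(** Opposite signs of [R_z] and [sqrt 3 - sqrt (2 + 2 c)] make the second term
    of the right-hand side negative; the bound on [c] absorbs the constants
    that remain after replacing [|R_z| / R] by its lower bound [1 / (C z)]. *)
Lemma ltb_rhs_neg (C : R) (Rad : R -> R) (z c : R) :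
  0 < C -> 0 < z -> 0 < Rad z -> Rad z < C * z * Rabs (Derive Rad z) ->
  0 < c ->
  Derive Rad z * (sqrt 3 - sqrt (2 + 2 * c)) < 0 ->
  sqrt 2 * C * Rabs (sqrt 3 - sqrt (2 + 2 * c)) <= c ->
  ltb_rhs Rad z c < 0.
Proof.
intros HC Hz HR HRz Hc Hsign Hlevel; unfold ltb_rhs.
set (d := sqrt 3 - sqrt (2 + 2 * c)) in *.
set (D := Derive Rad z) in *.
assert (Hd : d <> 0) by (intros H; rewrite H in Hsign; lra).
assert (HD : D <> 0) by (intros H; rewrite H in Hsign; lra).
apply Rabs_pos_lt in HD.
pose proof (Rabs_pos_lt _ Hd) as Hd'.
assert (Hprod : D * d = - (Rabs D * Rabs d)).
{ rewrite <- Rabs_mult, Rabs_left by exact Hsign; ring. }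
assert (Hsq : d * d = Rabs d * Rabs d).
{ rewrite <- Rabs_mult, Rabs_right; [reflexivity | nra]. }
assert (Hquot : D / d = - (Rabs D / Rabs d)).
{ replace (D / d) with (D * d / (d * d)) by (field; exact Hd).
  rewrite Hprod, Hsq; field; lra. }
replace 6 with (3 * 2) by ring.
rewrite sqrt_mult by lra.
assert (H3 : 0 < sqrt 3) by (apply sqrt_lt_R0; lra).
assert (H2 : 0 < sqrt 2) by (apply sqrt_lt_R0; lra).
assert (Hs : 0 < sqrt (1 + c)) by (apply sqrt_lt_R0; lra).
replace (sqrt 3 * sqrt 2 * sqrt (1 + c) / (1 + z) +
         c * (D / Rad z) * (sqrt 3 * sqrt (1 + c) / d))
  with (sqrt 3 * sqrt (1 + c) * (sqrt 2 / (1 + z) + c / Rad z * (D / d)))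
  by (field; lra).
rewrite Hquot.
set (a := Rabs D) in *; set (b := Rabs d) in *.
replace (sqrt 2 / (1 + z) + c / Rad z * - (a / b))
  with (- ((c * a * (1 + z) - sqrt 2 * Rad z * b) / ((1 + z) * Rad z * b)))
  by (field; lra).
assert (Hnum : 0 < c * a * (1 + z) - sqrt 2 * Rad z * b).
{ assert (sqrt 2 * b * Rad z < sqrt 2 * b * (C * z * a)).
  { apply Rmult_lt_compat_l; [apply Rmult_lt_0_compat |]; assumption. }
  assert (sqrt 2 * C * b * (z * a) <= c * (z * a)).
  { apply Rmult_le_compat_r; [nra | exact Hlevel]. }
  assert (0 < c * a) by nra.
  nra. }
assert (Hden : 0 < (1 + z) * Rad z * b).
{ repeat apply Rmult_lt_0_compat; lra. }
pose proof (Rdiv_lt_0_compat _ _ Hnum Hden).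
assert (0 < sqrt 3 * sqrt (1 + c)) by (apply Rmult_lt_0_compat; assumption).
nra.
Qed.

(** The sign hypothesis covers both cases of the theorem at once: [R_z < 0] with
    [c < 1/2], and [R_z > 0] with [c > 1/2]. *)
Lemma xi_le_level (C : R) (Rad : R -> R) (z0 : R) (z1 : Rbar) (xi0 c : R)
    (xi : R -> R) :
  0 < C -> smooth_pos Rad -> 0 < z0 ->
  (forall z, Ico z0 z1 z -> Rad z < C * z * Rabs (Derive Rad z)) ->
  ltb_solution Rad z0 z1 xi0 xi ->
  0 < c -> xi0 <= c ->
  sqrt 2 * C * Rabs (sqrt 3 - sqrt (2 + 2 * c)) <= c ->
  (forall z, Ico z0 z1 z ->
     Derive Rad z * (sqrt 3 - sqrt (2 + 2 * c)) < 0) ->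
  forall z, Ico z0 z1 z -> xi z <= c.
Proof.
intros HC [Hpos _] Hz0 HR [Hini Hsol] Hc Hxi0 Hlevel Hsign.
apply (barrier xi (fun y => ltb_rhs Rad y (xi y))).
- intros z Hz; apply (Hsol z Hz).
- rewrite Hini; exact Hxi0.
- intros z Hz ->.
  assert (0 < z) by (destruct Hz; lra).
  apply (ltb_rhs_neg C); auto.
Qed.

Lemma sqrt_gap_pos (c : R) : 0 < c -> c < 1 / 2 -> 0 < sqrt 3 - sqrt (2 + 2 * c).
Proof.
intros H0 H; assert (sqrt (2 + 2 * c) < sqrt 3) by (apply sqrt_lt_1; lra); lra.
Qed.

Lemma sqrt_gap_neg (c : R) : 1 / 2 < c -> sqrt 3 - sqrt (2 + 2 * c) < 0.
Proof.
intros H; assert (sqrt 3 < sqrt (2 + 2 * c)) by (apply sqrt_lt_1; lra); lra.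
Qed.

(** Rationalising, [sqrt 3 - sqrt (2 + 2 c)] is
    [(1 - 2 c) / (sqrt 3 + sqrt (2 + 2 c))], hence at most [1 - 2 c]: the gap
    closes as [c] approaches [1/2] while [c] itself stays away from [0]. *)
Lemma barrier_level_below (C xi0 : R) : 0 < C ->
  exists c, 0 < c < 1 / 2 /\ (xi0 < 1 / 2 -> xi0 <= c) /\
    sqrt 2 * C * Rabs (sqrt 3 - sqrt (2 + 2 * c)) <= c.
Proof.
intros HC.
(* The value [1/2 - k] solves [2 C (1 - 2 c) = c], where [2] bounds [sqrt 2]. *)
pose (k := 1 / (2 * (4 * C + 1))).
assert (Hk : 0 < k) by (apply Rdiv_lt_0_compat; lra).
assert (Hk' : k * (2 * (4 * C + 1)) = 1) by (unfold k; field; lra).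
assert (Hlev : exists c, 1 / 2 - k <= c < 1 / 2 /\ (xi0 < 1 / 2 -> xi0 <= c)).
{ destruct (Rlt_or_le xi0 (1 / 2)) as [H | H].
  - exists (Rmax xi0 (1 / 2 - k)).
    split; [split; [apply Rmax_r | apply Rmax_lub_lt; lra] |].
    intros _; apply Rmax_l.
  - exists (1 / 2 - k); lra. }
destruct Hlev as [c [Hc Hxi]].
assert (Hc0 : 0 < c) by nra.
exists c; split; [lra | split; [exact Hxi |]].
pose proof (sqrt_gap_pos c Hc0 (proj2 Hc)) as Hgap.
rewrite Rabs_right by lra.
assert (H3 : 1 <= sqrt 3) by (rewrite <- sqrt_1 at 1; apply sqrt_le_1; lra).
assert (H3s : sqrt 3 * sqrt 3 = 3) by (apply sqrt_sqrt; lra).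
assert (Hss : sqrt (2 + 2 * c) * sqrt (2 + 2 * c) = 2 + 2 * c)
  by (apply sqrt_sqrt; lra).
pose proof (sqrt_pos (2 + 2 * c)).
set (g := sqrt 3 - sqrt (2 + 2 * c)) in *.
assert (Hg : g <= 1 - 2 * c) by (unfold g in *; nra).
assert (H2 : sqrt 2 <= 2).
{ rewrite <- (sqrt_square 2) at 2 by lra; apply sqrt_le_1; lra. }
assert (sqrt 2 * (C * g) <= 2 * (C * g)) by (apply Rmult_le_compat_r; nra).
assert (C * g <= C * (1 - 2 * c)) by (apply Rmult_le_compat_l; lra).
nra.
Qed.

(** With [s = sqrt (2 + 2 c)] the level is [c = s^2 / 2 - 1], quadratic in [s],
    whereas the gap is less than [s]. *)
Lemma barrier_level_above (C xi0 : R) : 0 < C ->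
  exists c, 1 / 2 < c /\ xi0 <= c /\
    sqrt 2 * C * Rabs (sqrt 3 - sqrt (2 + 2 * c)) <= c.
Proof.
intros HC.
pose (k := 4 * C + 2).
pose (c := Rmax xi0 (k * k / 2)).
assert (Hk : k * k / 2 <= c) by apply Rmax_r.
assert (Hc : 1 / 2 < c) by (unfold k in *; nra).
exists c; split; [exact Hc | split; [apply Rmax_l |]].
pose proof (sqrt_gap_neg c Hc) as Hgap.
rewrite Rabs_left by exact Hgap.
assert (Hss : sqrt (2 + 2 * c) * sqrt (2 + 2 * c) = 2 + 2 * c)
  by (apply sqrt_sqrt; lra).
assert (Hs : k <= sqrt (2 + 2 * c)).
{ rewrite <- (sqrt_square k) by (unfold k; lra).
  apply sqrt_le_1; unfold k in *; nra. }
assert (H2 : sqrt 2 <= 2).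
{ rewrite <- (sqrt_square 2) at 2 by lra; apply sqrt_le_1; lra. }
pose proof (sqrt_pos 3).
set (s := sqrt (2 + 2 * c)) in *.
assert (sqrt 2 * (C * (s - sqrt 3)) <= 2 * (C * (s - sqrt 3)))
  by (apply Rmult_le_compat_r; nra).
(* Since [s >= 4 C + 2], [2 C s <= s (s - 2) / 2 <= s^2 / 2 - 1]. *)
assert (2 * (C * (s - sqrt 3)) <= 2 * (C * s)) by nra.
assert (2 * (C * s) <= c) by (unfold k in *; nra).
nra.
Qed.

Theorem theorem1 (C xi0 : R) (hC : 0 < C) :
  exists c1 c2 : R, 0 < c1 /\ c1 < 1 / 2 /\ 1 / 2 < c2 /\
    forall (Rad : R -> R) (z0 : R) (z1 : Rbar) (xi M : R -> R),
      smooth_pos Rad ->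
      0 < z0 -> Rbar_lt (Finite z0) z1 ->
      (forall z, Ico z0 z1 z -> Rad z < C * z * Rabs (Derive Rad z)) ->
      ltb_solution Rad z0 z1 xi0 xi ->
      (forall z, Ico z0 z1 z -> M z = Rad z * xi z) ->
      (0 < xi0 < 1 / 2 ->
       (forall z, Ico z0 z1 z -> Derive Rad z < 0) ->
       forall z, Ico z0 z1 z -> M z <= c1 * Rad z) /\
      (1 / 2 < xi0 ->
       (forall z, Ico z0 z1 z -> 0 < Derive Rad z) ->
       forall z, Ico z0 z1 z -> M z <= c2 * Rad z).
Proof.
destruct (barrier_level_below C xi0 hC) as [c1 [[Hc1 Hc1'] [Hx1 Hl1]]].
destruct (barrier_level_above C xi0 hC) as [c2 [Hc2 [Hx2 Hl2]]].
exists c1, c2; do 3 (split; [assumption |]).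
intros Rad z0 z1 xi M Hsm Hz0 _ HR Hsol HM.
assert (HMle : forall c z, Ico z0 z1 z -> xi z <= c -> M z <= c * Rad z).
{ intros c z Hz Hxi; rewrite (HM z Hz), (Rmult_comm c).
  apply Rmult_le_compat_l; [| exact Hxi].
  apply Rlt_le, Hsm; destruct Hz; lra. }
split; intros Hxi0 HD z Hz; apply (HMle _ z Hz); revert z Hz.
- apply (xi_le_level C Rad z0 z1 xi0); auto.
  + apply Hx1; lra.
  + intros z Hz; pose proof (HD z Hz).
    pose proof (sqrt_gap_pos c1 Hc1 Hc1'); nra.
- apply (xi_le_level C Rad z0 z1 xi0); auto.
  + lra.
  + intros z Hz; pose proof (HD z Hz).
    pose proof (sqrt_gap_neg c2 Hc2); nra.
Qed.
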